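(* Let $0<H<1$, let $(a,b)\in\mathbb{R}^2\setminus\{(0,0)\}$, and let $(Z_t^H)_{t\ge0}=(Z_t^H(a,b))_{t\ge 0}$ be the generalized fractional Brownian motion with parameters $a,b,H$. Then on each time interval $[0,T]\subset[0,+\infty)$ with $T>0$, the process $(Z_t^H)_{0\le t\le T}$ almost surely admits a local time $L^H([0,T],x)$, $x\in\mathbb{R}$, which satisfies $$\int_{\mathbb{R}}L^H([0,T],x)^2\,dx<\infty\quad\text{almost surely}.$$
   Context: For $H\in(0,1)$, a two-sided fractional Brownian motion with Hurst parameter $H$ is a centered Gaussian process $B^H=(B_t^H)_{t\in\mathbb{R}}$ on a probability space $(\Omega,F,\mathbb{P})$ with covariance $\operatorname{Cov}(B_t^H,B_s^H)=\frac12\bigl(|s|^{2H}+|t|^{2H}-|t-s|^{2H}\bigr)$ for $s,t\in\mathbb{R}$. For real $a,b$ with $(a,b)\ne(0,0)$, the generalized fractional Brownian motion (gfBm) with parameters $a,b,H$ is the process $Z^H=(Z_t^H)_{t\ge0}$ defined by $Z_t^H=Z_t^H(a,b)=aB_t^H+bB_{-t}^H$ for $t\ge 0$, taken here with continuous sample paths (a continuous version). The local time $L^H([0,T],\cdot)$ of a path on $[0,T]$ is the density with respect to Lebesgue measure (when it exists) of the occupation measure $A\mapsto\lambda\{t\in[0,T]:Z_t^H\in A\}$, $A\subset\mathbb{R}$ Borel, where $\lambda$ is Lebesgue measure. *)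

(* Defs.v *)
From HB Require Import structures.
From mathcomp Require Import all_boot all_order all_algebra.
From mathcomp Require Import all_classical all_reals all_analysis.

Set Implicit Arguments.
Unset Strict Implicit.
Unset Printing Implicit Defensive.

Import Order.TTheory GRing.Theory Num.Theory.
Import numFieldNormedType.Exports.

Local Open Scope classical_set_scope.
Local Open Scope ring_scope.

(* Degenerate (constant) laws count as Gaussian.  They are listed apart because
   [normal_prob m 0] is not a Dirac mass in the library. *)
Definition gaussian_law (R : realType) (mu : set R -> \bar R) : Prop :=
  exists m : R,
    (exists2 s : R, 0 < s &
       forall A : set R, measurable A -> mu A = normal_prob m s A) \/
    (forall A : set R, measurable A -> mu A = \d_m A).

Definition gaussian_process (d : measure_display) (Omega : measurableType d)
    (R : realType) (P : probability Omega R) (I : Type)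
    (X : I -> {RV P >-> R}) : Prop :=
  forall (n : nat) (t : 'I_n -> I) (c : 'I_n -> R),
    gaussian_law
      (pushforward P (fun w : Omega => \sum_(i < n) c i * X (t i) w)).

Definition fBm (d : measure_display) (Omega : measurableType d)
    (R : realType) (P : probability Omega R) (H : R)
    (B : R -> {RV P >-> R}) : Prop :=
  [/\ gaussian_process B,
      forall t : R, 'E_P[B t]%E = 0%E
    & forall s t : R,
        covariance P (B t) (B s) =
        (2^-1 * (`|s| `^ (2 * H) + `|t| `^ (2 * H) - `|t - s| `^ (2 * H)))%:E].

(* The time set of [Z] is [0, +oo[; its values at negative times are
   unconstrained.  [Z] is a version of [a B_t + b B_{-t}], all of whose paths
   are continuous. *)
Definition gfBm (d : measure_display) (Omega : measurableType d)
    (R : realType) (P : probability Omega R) (H a b : R)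
    (Z : R -> {RV P >-> R}) : Prop :=
  exists B : R -> {RV P >-> R},
    [/\ fBm H B,
        forall t : R, 0 <= t ->
          {ae P, forall w : Omega, Z t w = a * B t w + b * B (- t) w}
      & forall w : Omega,
          {within `[0, +oo[, continuous (fun t : R => Z t w)}].

Definition occupation_measure (R : realType) (z : R -> R) (T : R)
    (A : set R) : \bar R :=
  lebesgue_measure [set t : R | 0 <= t <= T /\ A (z t)].

Definition local_time (R : realType) (z : R -> R) (T : R) (L : R -> R) : Prop :=
  [/\ measurable_fun setT L,
      forall x : R, 0 <= L x
    & forall A : set R, measurable A ->
        occupation_measure z T A = (\int[lebesgue_measure]_(x in A) (L x)%:E)%E].

(* Main.v *)
Require Import Defs.
From HB Require Import structures.
From mathcomp Require Import all_boot all_order all_algebra.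
From mathcomp Require Import all_classical all_reals all_analysis.
From mathcomp Require Import measurable_realfun ring lra.

(* The occupation measure mu of a path on [0, T] has a square integrable density
   as soon as, along some sequence e -> 0, the integrals of mu(B(y, 2e)) / (2e)
   against mu(dy) stay bounded.  Indeed these integrals dominate the squared L^2
   norms of the averages mu(B(x, e)) / (2e); boundedness of the latter forces mu
   to be absolutely continuous, and then the averages converge almost everywhere
   to the density, which is square integrable by Fatou's lemma.
   By Tonelli, the expectation of such an integral is (2e)^-1 times the double
   integral of P(|Z_t - Z_s| < 2e) over [0, T]^2.  Since Z_t - Z_s is centered
   Gaussian with variance at least c |t - s|^(2H), it is at most a constant
   times the double integral of |t - s|^(-H), which is finite because H < 1.
   Fatou's lemma in e then gives a bounded sequence almost surely. *)

Set Implicit Arguments.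
Unset Strict Implicit.
Unset Printing Implicit Defensive.

Import Order.TTheory GRing.Theory Num.Theory.
Import numFieldNormedType.Exports.

Local Open Scope classical_set_scope.
Local Open Scope ring_scope.

Lemma measurable_norm_sub_lt d (T : measurableType d) (R : realType)
    (f g : T -> R) (e : R) :
  measurable_fun setT f -> measurable_fun setT g ->
  measurable [set z | (`|f z - g z| < e)%R].
Proof.
move=> mf mg.
have mfg : measurable_fun setT (fun z => `|f z - g z|).
  by apply: measurableT_comp => //; exact: measurable_funB.
have := measurable_fun_ltr mfg (measurable_cst e) measurableT
  (Y := [set true]) I.
by rewrite setTI.
Qed.

(** * Increments of powers *)

Section powR_inequalities.
Context {R : realType}.
Implicit Types p q x y m h : R.

(** With s = x + y, the ratios x/s and y/s lie in [0, 1], where u <= u^p since p <= 1; they add up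
    to 1, so multiplying by s^p gives the claim. *)
Lemma powR_subadditive p x y : 0 <= p <= 1 -> 0 <= x -> 0 <= y ->
  (x + y) `^ p <= x `^ p + y `^ p.
Proof.
move=> /andP[p0 p1] x0 y0.
have [xy0|xyN0] := eqVneq (x + y) 0.
  have [-> ->] : x = 0 /\ y = 0 by split; lra.
  by rewrite addr0 lerDl powR_ge0.
have s0 : 0 < x + y by rewrite lt_neqAle eq_sym xyN0 addr_ge0.
have part (z : R) : 0 <= z -> z <= x + y -> z / (x + y) * (x + y) `^ p <= z `^ p.
  move=> z0 zs; have [->|zN0] := eqVneq z 0; first by rewrite !mul0r powR_ge0.
  rewrite -[in leRHS](divfK xyN0 z) powRM//; last 2 first.
  - by rewrite divr_ge0// ltW.
  - exact: ltW.
  rewrite ler_wpM2r ?powR_ge0// ger1_powR//.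
  rewrite divr_gt0 ?(lt_neqAle 0 z) 1?eq_sym ?zN0//=.
  by rewrite ler_pdivrMr// mul1r.
have := lerD (part x x0 _) (part y y0 _).
rewrite -mulrDl -mulrDl divff// mul1r; apply; lra.
Qed.

Lemma powR_midpoint_convex p x y : 1 <= p -> 0 <= x -> 0 <= y ->
  ((x + y) / 2) `^ p <= (x `^ p + y `^ p) / 2.
Proof.
move=> p1 x0 y0.
have h01 : (0 <= (2^-1 : R) <= 1) by apply/andP; split; lra.
have := @convex_powR R p p1 (Itv01 (andP h01).1 (andP h01).2) x y.
rewrite !inE /= !in_itv/= !andbT => /(_ x0 y0).
rewrite [X in X `^ _]convRE convRE /= /unstable.onem.
rewrite (_ : 2^-1 * x + (1 - 2^-1) * y = (x + y) / 2); last by lra.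
by move/le_trans; apply; lra.
Qed.

(** Convexity of the power 1/q >= 1 is applied at x^q and y^q, and both sides are then raised to the
    power q. *)
Lemma powR_midpoint_concave q x y : 0 < q <= 1 -> 0 <= x -> 0 <= y ->
  (x `^ q + y `^ q) / 2 <= ((x + y) / 2) `^ q.
Proof.
move=> /andP[q0 q1] x0 y0.
have qV : 1 <= q^-1 by rewrite invf_ge1.
have := powR_midpoint_convex qV (powR_ge0 x q) (powR_ge0 y q).
rewrite -!powRrM mulfV ?gt_eqF// !powRr1// => xy.
have s0 : 0 <= (x `^ q + y `^ q) / 2 by rewrite divr_ge0// addr_ge0// powR_ge0.
have := ge0_ler_powR (ltW q0) _ _ xy.
rewrite !nnegrE powR_ge0 -powRrM mulVf ?gt_eqF// powRr1//; apply => //.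
by rewrite divr_ge0// addr_ge0.
Qed.

(* A constant [k < 1] is needed since [a = b] and [a = - b] are allowed.  For
   [p = 1 + q > 1], writing [x `^ p = x * x `^ q], the concavity and the
   subadditivity of [x `^ q] give [k = 2 `^ (p - 2)]. *)
Lemma powR_second_difference p : 0 < p < 2 ->
  exists2 k : R, 0 <= k < 1 &
    forall m h, 0 <= h <= m ->
      `|m `^ p - ((m + h) `^ p + (m - h) `^ p) / 2| <= k * h `^ p.
Proof.
move=> /andP[p0 p2]; have [p1|p1] := leP p 1.
  (* For p <= 1 both one-sided increments lie between 0 and h^p, by monotonicity and subadditivity.
     The expression is half their difference, hence k = 1/2. *)
  exists 2^-1; first by apply/andP; split; lra.
  move=> m h /andP[h0 hm].
  have m0 : 0 <= m by lra.
  have mh0 : 0 <= m - h by lra.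
  have p01 : 0 <= p <= 1 by rewrite ltW.
  have up : (m + h) `^ p <= m `^ p + h `^ p by exact: powR_subadditive.
  have lo : m `^ p <= (m - h) `^ p + h `^ p.
    by rewrite -{1}(subrK h m); exact: powR_subadditive.
  have i1 : m `^ p <= (m + h) `^ p.
    by rewrite ge0_ler_powR ?nnegrE//; lra.
  have i2 : (m - h) `^ p <= m `^ p.
    by rewrite ge0_ler_powR ?nnegrE//; lra.
  by rewrite ler_norml; apply/andP; split; lra.
exists (2 `^ (p - 2)).
  rewrite powR_ge0/= -(opprB 2 p) powRN invf_lt1 ?powR_gt0//.
  have r0 : 0 < 2 - p by lra.
  have := @gt0_ltr_powR R _ r0 1 2.
  by rewrite !nnegrE powR1; apply => //; lra.
move=> m h /andP[h0 hm].
have m0 : 0 <= m by lra.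
have mh0 : 0 <= m - h by lra.
have mh1 : 0 <= m + h by lra.
have cv := powR_midpoint_convex (ltW p1) mh1 mh0.
have e1 : (m + h + (m - h)) / 2 = m by lra.
rewrite e1 in cv.
rewrite ler0_norm ?subr_le0// opprB.
pose q := p - 1.
have q01 : 0 < q <= 1 by rewrite /q; apply/andP; split; lra.
have q01' : 0 <= q <= 1 by case/andP: q01 => /ltW -> ->.
have pE x : 0 <= x -> x `^ p = x * x `^ q by move=> x0; rewrite mulr_powRB1.
have cc := powR_midpoint_concave q01 mh1 mh0.
rewrite e1 in cc.
have sb : (m + h) `^ q <= (m - h) `^ q + (2 * h) `^ q.
  rewrite (_ : m + h = (m - h) + 2 * h); last by ring.
  by apply: powR_subadditive => //; lra.
have q2 : (2 * h) `^ q = 2 * (2 `^ (p - 2) * h `^ q).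
  rewrite powRM// mulrA; congr (_ * _).
  rewrite (_ : p - 2 = q - 1) ?/q; last by ring.
  by rewrite mulr_powRB1//; case/andP: q01.
rewrite !pE//.
(* The second difference splits as m ((m+h)^q + (m-h)^q)/2 - m m^q plus h ((m+h)^q - (m-h)^q)/2. The
   first part is nonpositive by concavity, the second is at most h (2h)^q / 2. *)
have key : m * (((m + h) `^ q + (m - h) `^ q) / 2 - m `^ q) <= 0.
  by rewrite mulr_ge0_le0// subr_le0.
have key2 : h * ((m + h) `^ q - (m - h) `^ q) <= h * (2 * (2 `^ (p - 2) * h `^ q)).
  by rewrite ler_wpM2l// -q2; lra.
move: key key2.
move: (_ `^ (p - 2)) ((m + h) `^ q) ((m - h) `^ q) (m `^ q) (h `^ q) => *.
nra.
Qed.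

(* The right-hand side is the variance of [Z_t - Z_s], for [p = 2 H]. *)
Lemma gfBm_increment_lower_bound (a b p : R) : 0 < p < 2 -> (a, b) <> (0, 0) ->
  exists2 c : R, 0 < c & forall s t, 0 <= s -> 0 <= t ->
    c * `|t - s| `^ p <=
    (a ^+ 2 + b ^+ 2) * `|t - s| `^ p +
    2 * (a * b) * ((t + s) `^ p - ((2 * t) `^ p + (2 * s) `^ p) / 2).
Proof.
move=> p02 ab0; have [k /andP[k0 k1] kP] := powR_second_difference p02.
have ab_gt0 : 0 < a ^+ 2 + b ^+ 2.
  rewrite lt_neqAle eq_sym paddr_eq0 ?sqr_ge0// !sqrf_eq0 addr_ge0 ?sqr_ge0//.
  by rewrite andbT; apply/negP => /andP[/eqP a0 /eqP b0]; apply: ab0; rewrite a0 b0.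
(* Since |2ab| <= a^2 + b^2, the cross term costs at most the fraction k of the leading term. *)
exists ((1 - k) * (a ^+ 2 + b ^+ 2)); first by rewrite mulr_gt0// subr_gt0.
move=> s t s0 t0.
have bound : `|(t + s) `^ p - ((2 * t) `^ p + (2 * s) `^ p) / 2|
    <= k * `|t - s| `^ p.
  wlog st : s t s0 t0 / s <= t.
    move=> W; have [|/ltW] := leP s t; first exact: W.
    by move=> ts; rewrite (distrC t) (addrC t) [X in X / 2]addrC; exact: W.
  rewrite (@ger0_norm _ (t - s)) ?subr_ge0//.
  have hyp : 0 <= t - s <= t + s by apply/andP; split; lra.
  (* The second difference is centered at t + s with step t - s, so its outer points are 2t and
     2s. *)
  have := kP _ _ hyp.
  rewrite (_ : t + s + (t - s) = 2 * t); last by ring.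
  by rewrite (_ : t + s - (t - s) = 2 * s); last by ring.
have k2 : `|2 * (a * b)| <= a ^+ 2 + b ^+ 2.
  have := sqr_ge0 (a - b); have := sqr_ge0 (a + b).
  by rewrite ler_norml => ? ?; apply/andP; split; nra.
move: bound; set D := _ - _ / 2; set h := `|t - s| `^ p => bound.
have h0 : 0 <= h by exact: powR_ge0.
have : `|2 * (a * b) * D| <= (a ^+ 2 + b ^+ 2) * (k * h).
  by rewrite normrM ler_pM.
by rewrite ler_norml => /andP[+ _]; lra.
Qed.

End powR_inequalities.

(** * Gaussian laws *)

Section gaussian_moments.
Context {R : realType}.
Notation leb := (@lebesgue_measure R).

(** The change of variables goes through the Radon-Nikodym derivative, which agrees almost
    everywhere with the normal density because both have the same integral over every measurable
    set. *)
Lemma ge0_integral_normal_prob (m s : R) (f : R -> \bar R) :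
  measurable_fun [set: R] f -> (forall x, 0 <= f x)%E ->
  (\int[normal_prob m s]_x f x =
   \int[leb]_x (f x * (normal_pdf m s x)%:E))%E.
Proof.
move=> mf f0; have dom := @normal_prob_dominates R m s.
have mpdf : measurable_fun setT (fun x : R => (normal_pdf m s x)%:E).
  by apply/measurable_EFinP; exact: measurable_normal_pdf.
have iRN := Radon_Nikodym_SigmaFinite.f_integrable dom.
rewrite -(Radon_Nikodym_SigmaFinite.change_of_variables dom)//.
apply: ge0_ae_eq_integral => //.
- by apply: emeasurable_funM => //; exact: measurable_int iRN.
- exact: emeasurable_funM.
- by move=> x _; rewrite mule_ge0// Radon_Nikodym_SigmaFinite.f_ge0.
- by move=> x _; rewrite mule_ge0// lee_fin normal_pdf_ge0.
have : ae_eq leb setT (Radon_Nikodym_SigmaFinite.f (normal_prob m s) leb)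
    (fun x => (normal_pdf m s x)%:E).
  apply: integral_ae_eq => // E _ mE.
  by rewrite -Radon_Nikodym_SigmaFinite.f_integral.
by apply: filterS => x /= + xT => ->.
Qed.

(* Comparison with the density of standard deviation [2 * s] bounds the second
   moment up to a constant, which is all that is needed to bound [s] from below
   by the variance. *)
Lemma normal_pdf_second_moment_le (m s x : R) : 0 < s ->
  (x - m) ^+ 2 * normal_pdf m s x <= 16 * s ^+ 2 * normal_pdf m (2 * s) x.
Proof.
move=> s0; have s20 : 0 < 2 * s by rewrite mulr_gt0.
rewrite !normal_pdfE ?gt_eqF// /normal_fun.
have -> : normal_peak (2 * s) = normal_peak s / 2.
  rewrite /normal_peak exprMn -mulrA -mulrnAr sqrtrM ?sqr_ge0//.
  by rewrite sqrtr_sqr ger0_norm// invfM mulrC.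
(* This is the exponent of the wider density up to sign; that of the narrower one is four times as
   large. *)
set u := (x - m) ^+ 2 / ((2 * s) ^+ 2 *+ 2).
have uE : (x - m) ^+ 2 = 8 * s ^+ 2 * u.
  by rewrite /u; field; rewrite gt_eqF.
have -> : - (x - m) ^+ 2 / (s ^+ 2 *+ 2) = - (4 * u).
  by rewrite /u; field; rewrite gt_eqF.
rewrite mulNr -/u.
have u0 : 0 <= u by rewrite /u divr_ge0 ?sqr_ge0// mulrn_wge0// sqr_ge0.
(* This amounts to u <= 1 + 3u <= exp(3u). *)
have key : u * expR (- (4 * u)) <= expR (- u).
  rewrite -(@ler_pM2r _ (expR (4 * u))) ?expR_gt0//.
  rewrite -mulrA -!expRD addNr expR0 mulr1.
  have -> : - u + 4 * u = 3 * u by ring.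
  have := expR_ge1Dx (3 * u); lra.
rewrite {1}uE.
have -> : 8 * s ^+ 2 * u * (normal_peak s * expR (- (4 * u))) =
  8 * s ^+ 2 * normal_peak s * (u * expR (- (4 * u))) by ring.
have -> : 16 * s ^+ 2 * (normal_peak s / 2 * expR (- u)) =
  8 * s ^+ 2 * normal_peak s * expR (- u) by field.
by rewrite ler_wpM2l// !mulr_ge0 ?normal_peak_ge0 ?ltW.
Qed.

Lemma normal_prob_second_moment (m s : R) : 0 < s ->
  (\int[normal_prob m s]_x ((x - m) ^+ 2)%:E <= (16 * s ^+ 2)%:E)%E.
Proof.
move=> s0.
have msq : measurable_fun [set: R] (fun x : R => (x - m) ^+ 2).
  by apply: measurable_funX; exact: measurable_funB.
rewrite ge0_integral_normal_prob; last 2 first.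
- exact/measurable_EFinP.
- by move=> x; rewrite lee_fin sqr_ge0.
rewrite -[leRHS]mule1 -(integral_normal_pdf m (2 * s)).
rewrite -ge0_integralZl//; last 3 first.
- by apply/measurable_EFinP; exact: measurable_normal_pdf.
- by move=> x _; rewrite lee_fin normal_pdf_ge0.
- by rewrite lee_fin mulr_ge0// sqr_ge0.
apply: ge0_le_integral => //.
- by move=> x _; rewrite -EFinM lee_fin mulr_ge0 ?sqr_ge0// normal_pdf_ge0.
- under eq_fun do rewrite -EFinM; apply/measurable_EFinP.
  by apply: measurable_funM => //; exact: measurable_normal_pdf.
- under eq_fun do rewrite -EFinM; apply/measurable_EFinP.
  by apply: measurable_funM => //; exact: measurable_normal_pdf.
- by move=> x _; rewrite -!EFinM lee_fin normal_pdf_second_moment_le.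
Qed.

(** The density never exceeds its peak, which is at most 1/s, and the ball has length 2r. *)
Lemma normal_prob_ball_le (m s x r : R) : 0 < s -> 0 < r ->
  (normal_prob m s (ball x r) <= (2 * r / s)%:E)%E.
Proof.
move=> s0 r0; rewrite /normal_prob.
apply: (@le_trans _ _ (\int[leb]_(y in ball x r) (s^-1)%:E)%E).
  apply: ge0_le_integral => //.
  - exact: measurable_ball.
  - by move=> y _; rewrite lee_fin normal_pdf_ge0.
  - apply: measurable_funTS; apply/measurable_EFinP; exact: measurable_normal_pdf.
  - move=> y _; rewrite lee_fin (le_trans (normal_pdf_ub _ _ _))// ?gt_eqF//.
    rewrite /normal_peak lef_pV2 ?posrE//; last first.
      by rewrite sqrtr_gt0 mulrn_wgt0// mulr_gt0 ?pi_gt0// exprn_gt0.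
    rewrite -[leLHS](ger0_norm (ltW s0)) -sqrtr_sqr ler_wsqrtr//.
    rewrite -mulr_natr -mulrA ler_peMr ?sqr_ge0//.
    by have := @pi_ge2 R; lra.
rewrite integral_cst//=; last exact: measurable_ball.
rewrite lebesgue_measure_ball; last exact: ltW.
by rewrite -EFinM lee_fin (_ : s^-1 * (r *+ 2) = 2 * r / s)//; ring.
Qed.

End gaussian_moments.

Section gaussian_random_variables.
Context d (Omega : measurableType d) (R : realType) (P : probability Omega R).
Implicit Type Y : {RV P >-> R}.

Lemma measurable_sqr_centered Y (m : R) :
  measurable_fun setT (fun w => ((Y w - m) ^+ 2)%:E).
Proof.
by apply/measurable_EFinP; apply: measurable_funX; exact: measurable_funB.
Qed.

(* [R] and [measurableTypeR R], on which [normal_prob] is defined, have the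
   same measurable sets but different displays. *)
Lemma integral_law Y (mu : {measure set (measurableTypeR R) -> \bar R})
    (f : R -> \bar R) :
  (forall A : set R, measurable A -> pushforward P Y A = mu A) ->
  measurable_fun [set: R] f -> (forall y, 0 <= f y)%E ->
  (\int[P]_w f (Y w) = \int[mu]_y f y)%E.
Proof.
move=> YE mf f0.
have mY : measurable_fun setT (Y : Omega -> measurableTypeR R).
  move=> _ A mA; exact: (@measurable_funP _ _ Omega R setT Y measurableT A mA).
have := @ge0_integral_pushforward _ _ _ _ _ _ mY P setT f measurableT mf.
rewrite preimage_setT => <-; last by move=> y _; exact: f0.
by apply: eq_measure_integral => A mA _; exact: YE.
Qed.

Lemma normal_law_second_moment Y (m s : R) : 0 < s ->
  (forall A, measurable A -> pushforward P Y A = normal_prob m s A) ->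
  (\int[P]_w ((Y w - m) ^+ 2)%:E <= (16 * s ^+ 2)%:E)%E.
Proof.
move=> s0 YN.
rewrite (integral_law (f := fun y => ((y - m) ^+ 2)%:E) YN).
- exact: normal_prob_second_moment.
- by apply/measurable_EFinP; apply: measurable_funX; exact: measurable_funB.
- by move=> y; rewrite lee_fin sqr_ge0.
Qed.

Lemma dirac_law_second_moment Y (m : R) :
  (forall A, measurable A -> pushforward P Y A = \d_m A) ->
  (\int[P]_w ((Y w - m) ^+ 2)%:E = 0)%E.
Proof.
move=> YD.
have mf : measurable_fun [set: R] (fun y : R => ((y - m) ^+ 2)%:E).
  by apply/measurable_EFinP; apply: measurable_funX; exact: measurable_funB.
rewrite (@integral_law Y (@dirac _ (measurableTypeR R) m R)
  (fun y => ((y - m) ^+ 2)%:E))//.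
- by rewrite integral_dirac// diracT mul1e subrr expr0n.
- by move=> y; rewrite lee_fin sqr_ge0.
Qed.

(** The moment about [m] is finite for both kinds of law, and Y^2 <= 2(Y - m)^2 + 2m^2, the gap
    being (Y - 2m)^2. *)
Lemma integrable_sqr_gaussian Y : gaussian_law (pushforward P Y) ->
  P.-integrable setT (fun w => (Y w ^+ 2)%:E).
Proof.
move=> [m YG].
have Ym : (\int[P]_w ((Y w - m) ^+ 2)%:E < +oo)%E.
  case: YG => [[s s0]|].
    by move/(normal_law_second_moment s0)/le_lt_trans; apply; rewrite ltry.
  by move/dirac_law_second_moment ->; rewrite ltry.
have iYm : P.-integrable setT
    (fun w => ((Y w - m) ^+ 2)%:E + ((Y w - m) ^+ 2)%:E + (2 * m ^+ 2)%:E)%E.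
  have i1 : P.-integrable setT (fun w => ((Y w - m) ^+ 2)%:E).
    apply/integrableP; split; first exact: measurable_sqr_centered.
    by under eq_integral do rewrite gee0_abs ?lee_fin ?sqr_ge0//.
  apply: integrableD => //; first exact: integrableD.
  exact: finite_measure_integrable_cst.
apply: le_integrable iYm => //.
  by apply/measurable_EFinP; apply: measurable_funX.
move=> w _ /=; rewrite lee_fin !ger0_norm ?sqr_ge0//; last first.
  by rewrite !addr_ge0// ?sqr_ge0// mulr_ge0// sqr_ge0.
by have := sqr_ge0 (Y w - 2 * m); lra.
Qed.

Lemma integrable_mul_sqr (X Y : {RV P >-> R}) :
  P.-integrable setT (fun w => (X w ^+ 2)%:E) ->
  P.-integrable setT (fun w => (Y w ^+ 2)%:E) ->
  P.-integrable setT (fun w => (X w * Y w)%:E).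
Proof.
move=> iX iY; apply: (le_integrable _ _ _ (integrableD _ iX iY)) => //.
  by apply/measurable_EFinP; exact: measurable_funM.
move=> w _ /=; rewrite lee_fin [leRHS]ger0_norm ?addr_ge0 ?sqr_ge0//.
by rewrite ler_norml; have := sqr_ge0 (X w + Y w); have := sqr_ge0 (X w - Y w);
  move=> ? ?; apply/andP; split; nra.
Qed.

Lemma integrable_of_sqr Y : P.-integrable setT (fun w => (Y w ^+ 2)%:E) ->
  P.-integrable setT (fun w => (Y w)%:E).
Proof.
move=> iY; have i1 := finite_measure_integrable_cst P (1 : R) measurableT.
apply: (le_integrable _ _ _ (integrableD _ iY i1)) => //.
  exact/measurable_EFinP.
move=> w _ /=; rewrite lee_fin [leRHS]ger0_norm ?addr_ge0 ?sqr_ge0//.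
by rewrite ler_norml; have := sqr_ge0 (Y w + 1); have := sqr_ge0 (Y w - 1);
  move=> ? ?; apply/andP; split; nra.
Qed.

(** The parameters of the law need not be identified: v <= v + m^2 = E(Y - m)^2 <= 16 s^2 gives sqrt
    v <= 4s, and the bound 2r/s on the mass of a ball becomes 8r / sqrt v. A Dirac law would force v
    + m^2 = 0, against v > 0. *)
Lemma gaussian_small_ball Y (v r : R) : gaussian_law (pushforward P Y) ->
  (\int[P]_w (Y w)%:E = 0)%E -> (\int[P]_w (Y w ^+ 2)%:E = v%:E)%E ->
  0 < v -> 0 < r ->
  (P [set w | (`|Y w| < r)%R] <= (8 * r / Num.sqrt v)%:E)%E.
Proof.
move=> YG EY EY2 v0 r0.
have iY2 := integrable_sqr_gaussian YG.
have iY := integrable_of_sqr iY2.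
have EYm m : (\int[P]_w ((Y w - m) ^+ 2)%:E = (v + m ^+ 2)%:E)%E.
  transitivity (\int[P]_w
      ((Y w ^+ 2)%:E + ((- 2 * m)%:E * (Y w)%:E + (m ^+ 2)%:E)))%E.
    by apply: eq_integral => w _; rewrite -EFinM -!EFinD; congr EFin; ring.
  have im := finite_measure_integrable_cst P (m ^+ 2) measurableT.
  rewrite integralD//; last by apply: integrableD => //; exact: integrableZl.
  rewrite integralD//; last exact: integrableZl.
  rewrite integralZl// EY mule0 add0e EY2 integral_cst//= probability_setT.
  by rewrite mule1.
case: YG => m [[s s0 YN]|YD]; last first.
  have := dirac_law_second_moment YD; rewrite EYm => /eqP.
  by rewrite eqe paddr_eq0 ?sqr_ge0 ?(ltW v0)// (gt_eqF v0).
have := normal_law_second_moment s0 YN; rewrite EYm lee_fin => vs.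
have sv : Num.sqrt v <= 4 * s.
  rewrite -[leRHS]ger0_norm; last by rewrite mulr_ge0// ltW.
  rewrite -sqrtr_sqr ler_wsqrtr// exprMn.
  by have := sqr_ge0 m; lra.
have -> : [set w | `|Y w| < r] = Y @^-1` ball 0 r.
  by apply/seteqP; split => w /=; rewrite /ball/= sub0r normrN.
have := YN _ (measurable_ball 0 r); rewrite /pushforward => ->.
apply: le_trans (normal_prob_ball_le m 0 s0 r0) _.
rewrite lee_fin (_ : 2 * r / s = 8 * r / (4 * s)); last by field; rewrite gt_eqF.
rewrite ler_wpM2l ?mulr_ge0 ?(ltW r0)//.
by rewrite lef_pV2 ?posrE ?sqrtr_gt0 ?mulr_gt0.
Qed.

End gaussian_random_variables.

(** * Moments of linear combinations of fractional Brownian motion *)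

Section fBm_combinations.
Context d (Omega : measurableType d) (R : realType) (P : probability Omega R).
Variables (H : R) (B : R -> {RV P >-> R}).
Hypothesis fB : fBm H B.

Let integrable_sqr_fBm t : P.-integrable setT (fun w => (B t w ^+ 2)%:E).
Proof.
apply: integrable_sqr_gaussian; case: fB => [gB _ _].
have := gB 1%N (fun=> t) (fun=> 1).
by under eq_fun do rewrite big_ord1 mul1r.
Qed.

Let mean_fBm t : (\int[P]_w (B t w)%:E = 0)%E.
Proof. by case: fB => [_ EB _]; have := EB t; rewrite unlock. Qed.

Lemma fBm_combination_mean n (t : 'I_n -> R) (c : 'I_n -> R) :
  (\int[P]_w (\sum_(i < n) c i * B (t i) w)%:E = 0)%E.
Proof.
under eq_integral do rewrite -sumEFin.
rewrite integral_sum//=; last first.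
  move=> i; under eq_fun do rewrite EFinM; apply: integrableZl => //.
  exact: integrable_of_sqr.
rewrite big1// => i _; under eq_integral do rewrite EFinM.
by rewrite integralZl ?mean_fBm ?mule0//; exact: integrable_of_sqr.
Qed.

Lemma fBm_combination_second_moment n (t : 'I_n -> R) (c : 'I_n -> R) :
  (\int[P]_w ((\sum_(i < n) c i * B (t i) w) ^+ 2)%:E =
   (\sum_(i < n) \sum_(j < n) c i * c j *
     (2^-1 * (`|t j| `^ (2 * H) + `|t i| `^ (2 * H)
              - `|t i - t j| `^ (2 * H))))%:E)%E.
Proof.
have covB u v : (\int[P]_w (B u w * B v w)%:E =
   (2^-1 * (`|v| `^ (2 * H) + `|u| `^ (2 * H) - `|u - v| `^ (2 * H)))%:E)%E.
  case: fB => [_ EB cB]; rewrite -cB covariance.unlock !EB/= unlock.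
  apply: eq_integral => w _; congr EFin.
  by change (B u w * B v w = (B u w - 0) * (B v w - 0)); rewrite !subr0.
have iB u v : P.-integrable setT (fun w => (B u w * B v w)%:E).
  exact: integrable_mul_sqr.
transitivity (\int[P]_w (\sum_(i < n) \sum_(j < n)
    (c i * c j)%:E * (B (t i) w * B (t j) w)%:E))%E.
  apply: eq_integral => w _; rewrite expr2 big_distrlr/= -sumEFin.
  apply: eq_bigr => i _; rewrite -sumEFin; apply: eq_bigr => j _.
  by rewrite -EFinM; congr EFin; ring.
rewrite integral_sum//=; last first.
  by move=> i; apply: integrable_sum => // j _; exact: integrableZl.
rewrite -sumEFin; apply: eq_bigr => i _.
rewrite integral_sum//=; last by move=> j; exact: integrableZl.
rewrite -sumEFin; apply: eq_bigr => j _.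
by rewrite integralZl// covB -EFinM.
Qed.

End fBm_combinations.

(** * Increments of generalized fractional Brownian motion *)

Section gfBm_increments.
Context d (Omega : measurableType d) (R : realType) (P : probability Omega R).

(** With weights a, b, -a, -b at times t, -t, s, -s the sum is the increment of a B_t + b B_{-t}
    between s and t, so this computes the variance bounded below earlier. *)
Lemma fBm_increment_second_moment (H : R) (B : R -> {RV P >-> R}) (a b s t : R) :
  fBm H B -> 0 < H -> 0 <= s -> 0 <= t ->
  let c := nth 0 [:: a; b; - a; - b] in let u := nth 0 [:: t; - t; s; - s] in
  (\int[P]_w ((\sum_(i < 4) c i * B (u i) w) ^+ 2)%:E =
   ((a ^+ 2 + b ^+ 2) * `|t - s| `^ (2 * H) + 2 * (a * b) *
    ((t + s) `^ (2 * H) - ((2 * t) `^ (2 * H) + (2 * s) `^ (2 * H)) / 2))%:E)%E.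
Proof.
move=> fB H0 s0 t0 c u.
rewrite (fBm_combination_second_moment fB (fun i => u i) (fun i => c i)).
congr EFin.
rewrite -[in RHS](@ger0_norm _ (t + s)) ?addr_ge0//.
rewrite -[in RHS](@ger0_norm _ (2 * t)) ?mulr_ge0//.
rewrite -[in RHS](@ger0_norm _ (2 * s)) ?mulr_ge0//.
(* Only two properties of the power of the absolute value enter the sixteen terms: it is even and
   vanishes at 0. The latter uses H > 0, since [powR 0 0] is 1. *)
have [f fE] : exists f : R -> R, forall x, `|x| `^ (2 * H) = f x by eexists.
have fN x : f (- x) = f x by rewrite -!fE normrN.
have f0 : f 0 = 0 by rewrite -fE normr0 powR0// gt_eqF// mulr_gt0.
under eq_bigr do under eq_bigr do rewrite !fE.
rewrite !fE.
have sum4 (g : nat -> R) : \sum_(i < 4) g i = g 0%N + g 1%N + g 2%N + g 3%N.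
  by rewrite !big_ord_recr big_ord0 /= add0r.
rewrite (sum4 (fun i => \sum_(j < 4)
  c i * c j * (2^-1 * (f (u j) + f (u i) - f (u i - u j))))).
rewrite !(sum4 (fun j => c _ * c j * (2^-1 * (f (u j) + f (u _) - f (u _ - u j))))).
rewrite (_ : c 0%N = a)// (_ : c 1%N = b)// (_ : c 2%N = - a)// (_ : c 3%N = - b)//.
rewrite (_ : u 0%N = t)// (_ : u 1%N = - t)// (_ : u 2%N = s)// (_ : u 3%N = - s)//.
rewrite !opprK !subrr !addNr f0 !fN.
rewrite (_ : f (- t - t) = f (2 * t)); last by rewrite -fN; congr f; ring.
rewrite (_ : f (- s - s) = f (2 * s)); last by rewrite -fN; congr f; ring.
rewrite (_ : f (t + t) = f (2 * t)); last by congr f; ring.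
rewrite (_ : f (s + s) = f (2 * s)); last by congr f; ring.
rewrite (_ : f (- t + s) = f (t - s)); last by rewrite -fN; congr f; ring.
rewrite (_ : f (- s + t) = f (t - s)); last by congr f; ring.
rewrite (_ : f (s - t) = f (t - s)); last by rewrite -fN; congr f; ring.
rewrite (_ : f (s + t) = f (t + s)); last by congr f; ring.
rewrite (_ : f (- t - s) = f (t + s)); last by rewrite -fN; congr f; ring.
rewrite (_ : f (- s - t) = f (t + s)); last by rewrite -fN; congr f; ring.
move: (f (2 * t)) (f (2 * s)) (f (t - s)) (f (t + s)) (f t) (f s) => *.
by field.
Qed.

Lemma probability_le_ae (A B : set Omega) : measurable A -> measurable B ->
  {ae P, forall w, A w -> B w} -> (P A <= P B)%E.
Proof.
move=> mA mB [N [mN PN0 sN]].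
rewrite (@le_trans _ _ (P (B `|` N)))//.
  apply: le_measure; rewrite ?inE//; first exact: measurableU.
  move=> w Aw; have [Nw|nNw] := pselect (N w); [by right|left].
  by apply: contrapT => nB; apply: nNw; apply: sN => /= AB; exact/nB/AB.
apply: le_trans (measureU2 P mB mN) _.
by rewrite [X in (_ + X)%E](PN0 : P N = 0%E) adde0.
Qed.

(** The increment is almost surely a linear combination of values of [B], hence centered Gaussian,
    with variance at least c |t - s|^(2H). The Gaussian small ball bound then gives the constant 8 /
    sqrt c. *)
Lemma gfBm_small_ball (H a b : R) (Z : R -> {RV P >-> R}) :
  0 < H -> H < 1 -> (a, b) <> (0, 0) -> gfBm H a b Z ->
  exists2 C : R, 0 < C & forall s t r : R, 0 <= s -> 0 <= t -> s != t -> 0 < r ->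
    (P [set w | (`|Z t w - Z s w| < r)%R] <= (C * r * `|t - s| `^ (- H))%:E)%E.
Proof.
move=> H0 H1 ab [B [fB ZB _]].
have p02 : 0 < 2 * H < 2 by apply/andP; split; lra.
have [c c0 cP] := gfBm_increment_lower_bound p02 ab.
exists (8 / Num.sqrt c); first by rewrite divr_gt0// sqrtr_gt0.
move=> s t r s0 t0 st r0.
pose k := nth 0 [:: a; b; - a; - b]; pose u := nth 0 [:: t; - t; s; - s].
pose Y w := \sum_(i < 4) k i * B (u i) w.
have mY : measurable_fun setT Y.
  by apply: measurable_sum => i; exact: measurable_funM.
pose Ym := isMeasurableFun.Build _ _ _ _ _ mY.
pose Y' : {mfun Omega >-> R} := HB.pack Y Ym.
have EY2 := fBm_increment_second_moment a b fB H0 s0 t0.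
set v := (X in X%:E) in EY2.
have hpos : 0 < `|t - s| by rewrite normr_gt0 subr_eq0 eq_sym.
have vge : c * `|t - s| `^ (2 * H) <= v by exact: cP.
have v0 : 0 < v by rewrite (lt_le_trans _ vge)// mulr_gt0// powR_gt0.
(* [Z] agrees with the combination of [B] only almost surely at each time; two fixed times are
   involved here, so two null sets are discarded. *)
apply: (@le_trans _ _ (P [set w | (`|Y' w| < r)%R])).
  apply: probability_le_ae.
  - exact: measurable_norm_sub_lt.
  - have := @measurable_norm_sub_lt _ _ _ Y' (cst 0) r mY (measurable_cst (0 : R)).
    by under eq_set do rewrite subr0.
  apply: filterS2 (ZB _ s0) (ZB _ t0) => w Zs Zt.
  rewrite /= Zs Zt /Y !big_ord_recr big_ord0 /= /k /u /= => ltr.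
  apply: le_lt_trans ltr; rewrite le_eqVlt; apply/orP; left; apply/eqP.
  by congr (`|_|); ring.
apply: le_trans (@gaussian_small_ball _ _ _ _ Y' v r _ _ EY2 v0 r0) _.
- by case: fB => + _ _; apply.
- exact: (fBm_combination_mean fB (fun i => u i) (fun i => k i)).
rewrite lee_fin powRN.
have h2 : `|t - s| `^ (2 * H) = (`|t - s| `^ H) ^+ 2.
  by rewrite mulrC powRrM -powR_mulrn// powR_ge0.
have sv : Num.sqrt c * `|t - s| `^ H <= Num.sqrt v.
  rewrite -[X in _ * X]ger0_norm ?powR_ge0// -sqrtr_sqr -sqrtrM ?(ltW c0)//.
  by rewrite -h2 ler_wsqrtr.
have -> : 8 / Num.sqrt c * r / `|t - s| `^ H =
  8 * r / (Num.sqrt c * `|t - s| `^ H).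
  by field; rewrite !gt_eqF ?sqrtr_gt0 ?powR_gt0.
rewrite ler_wpM2l ?mulr_ge0 ?(ltW r0)//.
by rewrite lef_pV2 ?posrE ?sqrtr_gt0 ?mulr_gt0 ?powR_gt0 ?sqrtr_gt0.
Qed.

End gfBm_increments.

(** * The singular kernel *)

Section singular_kernel.
Context {R : realType}.
Notation leb := (@lebesgue_measure R).

Lemma measurable_norm_powR (p : R) (A : set R) :
  measurable_fun A (fun u : R => (`|u| `^ p)%:E).
Proof.
apply/measurable_EFinP; apply: measurable_funTS.
by apply: (measurableT_comp (measurable_powR p)); exact: normr_measurable.
Qed.

Lemma measurable_singular_kernel (t p : R) (A : set R) :
  measurable_fun A (fun s : R => (`|t - s| `^ p)%:E).
Proof.
apply/measurable_EFinP; apply: measurable_funTS.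
apply: (measurableT_comp (measurable_powR _)).
by apply: (measurableT_comp (@normr_measurable _ setT)); exact: measurable_funB.
Qed.

(** Away from the singularity, the primitive u^(1-H) / (1-H) gives the value by the fundamental
    theorem of calculus. When T <= e the interval has at most one point. *)
Lemma integral_powR_le (H e T : R) : H < 1 -> 0 < e -> 0 < T ->
  (\int[leb]_(u in `[e, T]) (`|u| `^ (- H))%:E <= (T `^ (1 - H) / (1 - H))%:E)%E.
Proof.
move=> H1 e0 T0; have H10 : 0 < 1 - H by rewrite subr_gt0.
have [Te|eT] := leP T e.
  rewrite (@integral_Sset1 _ _ _ e)//.
    by rewrite lee_fin divr_ge0 ?powR_ge0// ltW.
  move=> x /=; rewrite in_itv/= => /andP[ex xT].
  by apply/eqP; rewrite eq_le ex (le_trans xT Te).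
have -> : (\int[leb]_(u in `[e, T]) (`|u| `^ (- H))%:E =
    \int[leb]_(u in `[e, T]) (u `^ (- H))%:E)%E.
  apply: eq_integral => u; rewrite inE /= in_itv/= => /andP[eu _].
  by rewrite ger0_norm// (le_trans _ eu)// ltW.
pose F u := u `^ (1 - H) / (1 - H).
have dF (u : R) : 0 < u -> is_derive u (1 : R) F (u `^ (- H)).
  move=> u0; rewrite /F.
  apply: is_derive_eq.
    by apply: is_deriveM; exact: is_derive1_powR.
  rewrite scaler0 add0r /GRing.scale/= mulrA mulVf ?gt_eqF// mul1r.
  by congr (_ `^ _); ring.
have cF (u : R) : 0 < u -> {for u, continuous F}.
  move=> u0; apply: differentiable_continuous; apply/derivable1_diffP.
  by have [] := dF _ u0.
rewrite (@continuous_FTC2 _ _ F)//.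
- by rewrite -EFinB lee_fin gerBl /F divr_ge0 ?powR_ge0// ltW.
- apply: continuous_in_subspaceT => u; rewrite inE /= in_itv/= => /andP[eu _].
  have u0 : 0 < u by rewrite (lt_le_trans e0).
  apply: differentiable_continuous; apply/derivable1_diffP.
  by have [] := is_derive1_powR (- H) u0.
- split.
  + move=> u; rewrite in_itv/= => /andP[eu _].
    by have [] := dF _ (lt_trans e0 eu).
  + by apply: cvg_at_right_filter; exact: cF.
  + by apply: cvg_at_left_filter; exact: cF.
- move=> u; rewrite in_itv/= => /andP[eu _].
  by rewrite derive1E; have [_ ->] := dF _ (lt_trans e0 eu).
Qed.

(** The bound on [e, T] does not depend on e, so it survives the monotone limit along e =
    1/(n+1). *)
Lemma integral0_powR_le (H T : R) : H < 1 -> 0 < T ->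
  (\int[leb]_(u in `]0%R, T]) (`|u| `^ (- H))%:E <= (T `^ (1 - H) / (1 - H))%:E)%E.
Proof.
move=> H1 T0; pose F n : set R := `[n.+1%:R^-1, T]%classic.
have -> : `]0%R, T]%classic = \bigcup_n F n.
  apply/seteqP; split => u; rewrite /F/=.
    rewrite in_itv/= => /andP[u0 uT].
    exists (Num.truncn u^-1) => //=; rewrite in_itv/= uT andbT.
    rewrite invf_ple ?posrE// ltW//.
    by have := truncnS_gt u^-1.
  case=> n _; rewrite /= !in_itv/= => /andP[nu ->]; rewrite andbT.
  by rewrite (lt_le_trans _ nu).
have cvgF : (\int[leb]_(u in F i) (`|u| `^ (- H))%:E)%E @[i --> \oo] -->
    (\int[leb]_(u in \bigcup_i F i) (`|u| `^ (- H))%:E)%E.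
  apply: ge0_nondecreasing_set_cvg_integral.
  - move=> m n mn; apply/subsetPset; apply: subset_itvr.
    by rewrite bnd_simp lef_pV2 ?posrE// ler_nat.
  - by move=> n; exact: measurable_itv.
  - by move=> n; exact: measurable_norm_powR.
  - by move=> n u _; rewrite lee_fin powR_ge0.
rewrite -(cvg_lim _ cvgF)//; apply: lime_le.
  by apply/cvg_ex; eexists; exact: cvgF.
by apply: nearW => n; apply: integral_powR_le => //; rewrite invr_gt0.
Qed.

Lemma lebesgue_measure_reflect (t : R) (A : set R) : measurable A ->
  pushforward leb (fun s : R => t - s : measurableTypeR R) A = leb A.
Proof.
move=> mA; apply/esym.
have mf : measurable_fun setT (fun s : R => t - s : measurableTypeR R).
  exact: measurable_funB.
apply: (@lebesgue_measure_unique _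
  (pushforward leb (fun s : R => t - s : measurableTypeR R))) => // _ [[x y]] _ <-.
rewrite /pushforward.
transitivity (leb `[t - y, t - x[%classic).
  rewrite !lebesgue_measure_itv/= !lte_fin ltrD2l ltrN2.
  by case: ifPn => // _; rewrite -!EFinB; congr EFin; ring.
congr (leb _); apply/seteqP; split => s; rewrite /= !in_itv/= => /andP[? ?];
  by apply/andP; split; lra.
Qed.

(** The reflection u = t - s sends [0, T] into [-T, T], where the kernel is even; this doubles the
    integral over ]0, T] and makes the bound uniform in t. *)
Lemma integral_singular_kernel_le (H t T : R) : 0 < H -> H < 1 -> 0 < T ->
  0 <= t <= T ->
  (\int[leb]_(s in `[0%R, T]) (`|t - s| `^ (- H))%:E <=
   (2 * (T `^ (1 - H) / (1 - H)))%:E)%E.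
Proof.
move=> H0 H1 T0 /andP[t0 tT].
pose g := (fun u : R => (`|u| `^ (- H))%:E) \_ `[- T, T].
have mg : measurable_fun [set: R] g.
  apply/(measurable_restrictT _ (measurable_itv _)).
  exact: measurable_norm_powR.
have g0 u : (0 <= g u)%E.
  by rewrite /g patchE; case: ifPn => // _; rewrite lee_fin powR_ge0.
have mf : @measurable_fun _ _ (measurableTypeR R) (measurableTypeR R) setT
    (fun s => t - s).
  exact: measurable_funB.
apply: (@le_trans _ _ (\int[leb]_s g (t - s)%R)%E).
  rewrite [leLHS]integral_mkcond; apply: ge0_le_integral => //.
  - by move=> s _; rewrite patchE; case: ifPn => // _; rewrite lee_fin powR_ge0.
  - apply/(measurable_restrictT _ (measurable_itv _)).
    exact: measurable_singular_kernel.
  - exact: measurableT_comp.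
  - move=> s _; rewrite /g !patchE; case: ifPn => [|_]; last exact: g0.
    rewrite !inE /= !in_itv/= => /andP[s0 sT].
    by rewrite ifT// inE/= in_itv/=; apply/andP; split; lra.
have -> : (\int[leb]_s g (t - s)%R = \int[leb]_s g s)%E.
  have := @ge0_integral_pushforward _ _ _ _ R _ mf leb setT g measurableT mg.
  rewrite preimage_setT => <-; last by move=> y _; exact: g0.
  by apply: eq_measure_integral => A mA _; exact: lebesgue_measure_reflect.
have -> : [set: R] = `]-oo, 0%R] `|` `]0%R, +oo[.
  apply/seteqP; split => // u _ /=; rewrite !in_itv/= andbT.
  by apply/orP; case: leP.
rewrite ge0_integral_setU//=; first last.
- apply/disj_setPS => u /=; rewrite !in_itv/= andbT => -[]; lra.
- exact: measurable_funTS.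
have gN u : g (- u) = g u.
  rewrite /g !patchE normrN; congr (if _ then _ else _).
  by apply/idP/idP; rewrite !inE/= !in_itv/= => /andP[? ?]; apply/andP; split; lra.
have -> : (\int[leb]_(u in `]-oo, 0%R]) g u = \int[leb]_(u in `]0%R, +oo[) g u)%E.
  rewrite integral_itv_obnd_cbnd; last exact: measurable_funTS.
  rewrite ge0_integration_by_substitution0//.
  by apply: eq_integral => u _; rewrite gN.
rewrite -mule2n -mule_natl EFinM lee_wpmul2l//.
apply: le_trans (integral0_powR_le H1 T0).
rewrite integral_mkcond [leRHS]integral_mkcond.
apply: ge0_le_integral => //.
- by move=> u _; rewrite patchE; case: ifPn.
- apply/(measurable_restrictT _ (measurable_itv _)); exact: measurable_funTS.
- apply/(measurable_restrictT _ (measurable_itv _)); exact: measurable_norm_powR.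
move=> u _; rewrite !patchE /g patchE.
have rhs0 : (0 <= if u \in `]0%R, T]%classic then (`|u| `^ (- H))%:E else 0)%E.
  by case: ifPn => // _; rewrite lee_fin powR_ge0.
case: ifPn => [/set_mem/=|_//]; rewrite in_itv/= andbT => u0.
case: ifPn => [/set_mem/=|_//]; rewrite in_itv/= => /andP[_ uT].
by rewrite ifT//; apply/mem_set; rewrite /= in_itv/= u0.
Qed.

End singular_kernel.

(** * Square integrable densities *)

Lemma limn_einf_le_cst (R : realType) (u : (\bar R)^nat) (K : \bar R) :
  (forall n, (u n <= K)%E) -> (limn_einf u <= K)%E.
Proof.
move=> uK; rewrite limn_einf_lim; apply: lime_le.
  exact: is_cvg_einfs.
apply: nearW => n; apply: le_trans (uK n).
by apply: ereal_inf_lbound; exists n => /=.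
Qed.

Lemma limn_einf_ge0 (R : realType) (u : (\bar R)^nat) :
  (forall n, (0 <= u n)%E) -> (0 <= limn_einf u)%E.
Proof.
move=> u0; rewrite limn_einf_lim; apply: lime_ge; first exact: is_cvg_einfs.
by apply: nearW => n; apply: le_ereal_inf_tmp => _ [k _ <-].
Qed.

Lemma measurable_fun_limn_einf d (T : measurableType d) (R : realType)
    (f : (T -> \bar R)^nat) : (forall n, measurable_fun setT (f n)) ->
  measurable_fun setT (fun x => limn_einf (f^~ x)).
Proof.
move=> mf; apply: measurableT_comp => //.
by apply: measurable_fun_limn_esup => n; exact: measurableT_comp.
Qed.

Section measurable_balls.
Context {R : realType}.
Notation RM := (measurableTypeR R).

Lemma measurable_dist_lt (e : R) :
  measurable [set z : RM * RM | (`|z.1 - z.2| < e)%R].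
Proof. exact: measurable_norm_sub_lt. Qed.

Lemma measurable_fun_measure_ball (mu : {sigma_finite_measure set RM -> \bar R})
    (e : R) :
  measurable_fun [set: R] (fun x : R => mu (ball x e)).
Proof.
suff -> : (fun x : R => mu (ball x e)) =
    mu \o xsection [set z : RM * RM | (`|z.1 - z.2| < e)%R].
  exact: measurable_fun_xsection (measurable_dist_lt e).
apply/funext => x /=; congr (mu _).
by apply/seteqP; split => y; rewrite /xsection /ball /= inE.
Qed.

(** Tonelli is applied to f(x) times the indicator of |x - y| < e, whose symmetry turns balls around
    x into balls around y. *)
Lemma integral_measure_ball (mu nu : {sigma_finite_measure set RM -> \bar R})
    (f : R -> \bar R) (e : R) : measurable_fun [set: R] f ->
  (forall x, 0 <= f x)%E ->
  (\int[nu]_x (f x * mu (ball x e)) =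
   \int[mu]_y \int[nu]_(x in ball y e) f x)%E.
Proof.
move=> mf f0.
pose A := [set z : RM * RM | (`|z.1 - z.2| < e)%R].
have mA : measurable A := measurable_dist_lt e.
pose F (z : RM * RM) := (f z.1 * (\1_A z)%:E)%E.
have mF : measurable_fun setT F.
  apply: emeasurable_funM; first exact: measurableT_comp mf measurable_fst.
  by apply/measurable_EFinP.
have F0 z : (0 <= F z)%E by rewrite mule_ge0// lee_fin.
have := @fubini_tonelli _ _ _ _ _ nu mu F mF F0.
have -> : (fun x => \int[mu]_y F (x, y))%E = (fun x => f x * mu (ball x e))%E.
  apply/funext => x; rewrite /F/= ge0_integralZl//.
  - rewrite (eq_integral (EFin \o \1_(ball x e : set RM))).
      by rewrite integral_indic ?setIT//; exact: measurable_ball.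
    by move=> y _ /=; rewrite !indicE.
  - by apply/measurable_EFinP; apply: measurableT_comp.
move=> ->; apply: eq_integral => y _.
rewrite [RHS]integral_mkcond; apply: eq_integral => x _; rewrite patchE /F/= indicE.
have -> : ((x, y) \in A) = (x \in (ball y e : set R)).
  by apply/idP/idP; rewrite !inE /A/= distrC.
by case: ifPn; rewrite ?mule1 ?mule0.
Qed.

Lemma measurable_fun_integral_ball (nu : {sigma_finite_measure set RM -> \bar R})
    (f : R -> \bar R) (e : R) : measurable_fun [set: R] f ->
  (forall x, 0 <= f x)%E ->
  measurable_fun [set: R] (fun y : R => \int[nu]_(x in ball y e) f x)%E.
Proof.
move=> mf f0.
pose A := [set z : RM * RM | (`|z.1 - z.2| < e)%R].
have mA : measurable A := measurable_dist_lt e.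
pose F (z : RM * RM) := (f z.2 * (\1_A z)%:E)%E.
have mF : measurable_fun setT F.
  apply: emeasurable_funM; first exact: measurableT_comp mf measurable_snd.
  by apply/measurable_EFinP.
have F0 z : (0 <= F z)%E by rewrite mule_ge0// lee_fin.
have := @measurable_fun_fubini_tonelli_F _ _ _ _ _ nu F mF F0.
rewrite (_ : fubini_F nu F = fun y : R => \int[nu]_(x in ball y e) f x)%E//.
apply/funext => y; rewrite /fubini_F [RHS]integral_mkcond.
apply: eq_integral => x _; rewrite patchE /F/= indicE.
have -> : ((y, x) \in A) = (x \in (ball y e : set R)).
  by apply/idP/idP; rewrite !inE.
by case: ifPn; rewrite ?mule1 ?mule0.
Qed.

End measurable_balls.

Section square_integrable_density.
Context {R : realType}.
Notation RM := (measurableTypeR R).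
Notation leb := (@lebesgue_measure R).
Variable mu : {finite_measure set RM -> \bar R}.

(** This is the density of the convolution of [mu] with the uniform law on ]-e, e[. *)
Definition ball_average (e x : R) : \bar R :=
  (mu (ball x e) * ((2 * e)^-1)%:E)%E.

Let measurable_mu_ball e : measurable_fun [set: R] (fun x : R => mu (ball x e)).
Proof. exact: (measurable_fun_measure_ball mu). Qed.

Let measurable_ball_average e : measurable_fun [set: R] (ball_average e).
Proof.
exact: (emeasurable_funM (measurable_mu_ball _) (measurable_cst _)).
Qed.

Let measurable_sqr_ball_average e :
  measurable_fun [set: R] (fun x => ball_average e x * ball_average e x)%E.
Proof. exact: emeasurable_funM. Qed.

Let ball_average_ge0 e x : 0 < e -> (0 <= ball_average e x)%E.
Proof. by move=> e0; rewrite mule_ge0// lee_fin invr_ge0 mulr_ge0// ltW. Qed.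

(** Tonelli opens one factor [mu (ball x e)] as an integral over y. For x within e of y, the ball of
    radius e at x lies in the ball of radius 2e at y, which bounds the other factor. *)
Lemma integral_sqr_ball_average (e : R) : 0 < e ->
  (\int[leb]_x (ball_average e x * ball_average e x) <=
   \int[mu]_y (mu (ball y (2 * e)) * ((2 * e)^-1)%:E))%E.
Proof.
move=> e0; have e20 : 0 < 2 * e by rewrite mulr_gt0.
have c0 : (0 <= ((2 * e)^-1)%:E)%E by rewrite lee_fin invr_ge0 ltW.
have -> : (\int[leb]_x (ball_average e x * ball_average e x) =
    \int[leb]_x (((2 * e)^-1)%:E * (ball_average e x * mu (ball x e))))%E.
  by apply: eq_integral => x _; rewrite {2}/ball_average muleA muleC.
rewrite ge0_integralZl//; last 2 first.
- exact: (emeasurable_funM (measurable_ball_average e) (measurable_mu_ball e)).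
- by move=> x _; rewrite mule_ge0// ball_average_ge0.
rewrite integral_measure_ball//; last by move=> x; exact: ball_average_ge0.
have mI : measurable_fun [set: R]
    (fun y : R => \int[leb]_(x in ball y e) ball_average e x)%E.
  exact: (measurable_fun_integral_ball _ _ (measurable_ball_average e)
    (fun x => ball_average_ge0 x e0)).
have I0 y : (0 <= \int[leb]_(x in ball y e) ball_average e x)%E.
  by apply: integral_ge0 => x _; exact: ball_average_ge0.
rewrite -ge0_integralZl//.
apply: ge0_le_integral => //.
- by move=> y _; rewrite mule_ge0.
- exact: emeasurable_funM.
- exact: (emeasurable_funM (measurable_mu_ball _) (measurable_cst _)).
move=> y _; set K := (mu (ball y (2 * e)) * _)%E.
(* The factor 2e inserted here is the length of [ball y e], over which the constant [K] is
   integrated. *)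
have -> : K = (((2 * e)^-1)%:E * (K * (2 * e)%:E))%E.
  by rewrite muleCA -EFinM mulVf ?gt_eqF// mule1.
rewrite lee_wpmul2l//.
apply: (@le_trans _ _ (\int[leb]_(x in ball y e) K)%E).
  apply: ge0_le_integral => //.
  - exact: measurable_ball.
  - by move=> x _; exact: ball_average_ge0.
  - exact: (measurable_funTS (measurable_ball_average e)).
  move=> x yx; rewrite /ball_average /K lee_wpmul2r//.
  apply: le_measure; rewrite ?inE; [exact: measurable_ball|exact: measurable_ball|].
  move=> z xz; rewrite (_ : 2 * e = e + e); last by ring.
  exact: ball_triangle yx xz.
rewrite integral_cst; last exact: measurable_ball.
by rewrite /= lebesgue_measure_ball ?(ltW e0)// /K !mulr_natl.
Qed.

(** Fatou bounds the mass of [U] by the limit inferior of the integrals of [g n], the fraction of a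
    small ball lying in [U]. By Tonelli, each integral over the whole line is the Lebesgue integral
    over [U] of a ball average; the parameter h balances its square against the length of [U]. *)
Lemma measure_open_le (e : R^nat) (M h : R) (U : set R) :
  (forall n, 0 < e n) -> e n @[n --> \oo] --> 0 -> 0 < h ->
  (forall n, \int[mu]_y (mu (ball y (2 * e n)) * ((2 * e n)^-1)%:E) <= M%:E)%E ->
  open U ->
  (mu U <= (h * M)%:E + ((4 * h)^-1)%:E * leb U)%E.
Proof.
move=> e0 ecvg h0 eM oU.
have mU : @measurable _ RM U by exact: open_measurable.
pose g n (y : R) := (leb (U `&` ball y (e n)) * ((2 * e n)^-1)%:E)%E.
have gE n y : g n y =
    (((2 * e n)^-1)%:E * \int[leb]_(x in ball y (e n)) (\1_U x)%:E)%E.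
  by rewrite /g integral_indic//; [rewrite muleC setIC|exact: measurable_ball].
have c0 n : (0 <= ((2 * e n)^-1)%:E)%E by rewrite lee_fin invr_ge0 mulr_ge0// ltW.
have g0 n y : (0 <= g n y)%E by rewrite /g mule_ge0.
have mI n : measurable_fun [set: R]
    (fun y : R => \int[leb]_(x in ball y (e n)) (\1_U x)%:E)%E.
  apply: (measurable_fun_integral_ball leb (e n) (f := EFin \o \1_U)).
    exact/measurable_EFinP.
  by move=> x; rewrite /= lee_fin.
have mg n : measurable_fun [set: R] (g n).
  rewrite (_ : g n = fun y => (((2 * e n)^-1)%:E *
    \int[leb]_(x in ball y (e n)) (\1_U x)%:E)%E); last exact/funext/gE.
  exact: emeasurable_funM.
(* As [U] is open, small balls around y lie inside it, and the fraction is eventually equal to 1. *)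
have gcvg y : U y -> limn_einf (g^~ y) = 1%E.
  move=> Uy; apply: (cvg_limn_einf_sup _).1.
  apply: cvg_near_cst.
  have /nbhs_ballP[r /= r0 rU] : nbhs y U by exact: open_nbhs_nbhs.
  have : \forall n \near \oo, e n < r.
    by move/cvgrPdist_lt : ecvg => /(_ r r0); apply: filterS => n;
       rewrite sub0r normrN gtr0_norm.
  apply: filterS => n en; rewrite /g.
  have -> : U `&` ball y (e n) = ball y (e n).
    by apply/setIidPr => z yz; apply: rU; exact: (le_ball (ltW en) yz).
  rewrite lebesgue_measure_ball ?(ltW (e0 n))// -EFinM mulr_natl mulfV//.
  by rewrite gt_eqF// mulrn_wgt0.
have gint n : (\int[mu]_(y in U) g n y <= (h * M)%:E + ((4 * h)^-1)%:E * leb U)%E.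
  have e20 : 0 < 2 * e n by rewrite mulr_gt0.
  have m1U : measurable_fun [set: R] (fun x : R => (\1_U x)%:E : \bar R).
    exact/measurable_EFinP.
  have mU2 : measurable_fun [set: R]
      (fun x : R => ((4 * h)^-1)%:E * (\1_U x)%:E)%E.
    exact: emeasurable_funM.
  have mA2 : measurable_fun [set: R]
      (fun x => h%:E * (ball_average (e n) x * ball_average (e n) x))%E.
    by apply: emeasurable_funM => //; exact: emeasurable_funM.
  have A20 x : (0 <= ball_average (e n) x * ball_average (e n) x)%E.
    by rewrite mule_ge0// ball_average_ge0.
  have h40 : (0 <= ((4 * h)^-1)%:E)%E by rewrite lee_fin invr_ge0 mulr_ge0// ltW.
  have hE0 : (0 <= h%:E)%E by rewrite lee_fin ltW.
  apply: (@le_trans _ _ (\int[mu]_y g n y)%E).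
    by apply: ge0_subset_integral => //; exact: mg.
  under eq_integral do rewrite gE.
  rewrite ge0_integralZl//; last 2 first.
  - exact: mI.
  - by move=> y _; apply: integral_ge0 => x _; rewrite lee_fin.
  have <- : (\int[leb]_x ((\1_U x)%:E * mu (ball x (e n))) =
      \int[mu]_y \int[leb]_(x in ball y (e n)) (\1_U x)%:E)%E.
    by apply: (integral_measure_ball mu leb (e n) m1U) => x; rewrite lee_fin.
  rewrite -ge0_integralZl//; last 2 first.
  - exact: (emeasurable_funM m1U (measurable_mu_ball (e n))).
  - by move=> x _; rewrite mule_ge0// lee_fin.
  (* AM-GM: [1_U * f <= h * f ^ 2 + 1_U / (4 * h)] for the average [f] *)
  apply: (@le_trans _ _ (\int[leb]_x
     (h%:E * (ball_average (e n) x * ball_average (e n) x) +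
      ((4 * h)^-1)%:E * (\1_U x)%:E))%E).
    apply: ge0_le_integral => //.
    - by move=> x _; rewrite !mule_ge0// lee_fin.
    - apply: emeasurable_funM => //.
      exact: (emeasurable_funM m1U (measurable_mu_ball (e n))).
    - exact: emeasurable_funD.
    move=> x _.
    have bA : ball_average (e n) x \is a fin_num.
      by rewrite fin_numM// fin_num_measure//; exact: measurable_ball.
    rewrite muleCA (muleC _ (mu _)) -/(ball_average (e n) x).
    rewrite -(fineK bA) -!EFinM -EFinD lee_fin indicE.
    move: (fine _) => r.
    case: (x \in U); rewrite /= ?mul0r ?mul1r ?mulr0 ?mulr1 ?addr0.
      have -> : h * (r * r) + (4 * h)^-1 = r + h * (r - (2 * h)^-1) ^+ 2.
        by field; rewrite gt_eqF.
      by rewrite lerDl mulr_ge0 ?sqr_ge0// ltW.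
    by rewrite mulr_ge0 ?(ltW h0)// -expr2 sqr_ge0.
  rewrite ge0_integralD//; last 2 first.
  - by move=> x _; rewrite mule_ge0.
  - by move=> x _; rewrite mule_ge0// lee_fin.
  rewrite !ge0_integralZl//; last first.
    exact: measurable_sqr_ball_average.
  rewrite integral_indic// setIT leeD2r// EFinM lee_wpmul2l//.
  exact: le_trans (integral_sqr_ball_average (e0 n)) (eM n).
have -> : mu U = (\int[mu]_(y in U) limn_einf (g^~ y))%E.
  rewrite (eq_integral (cst 1%E)); first by rewrite integral_cst// mul1e.
  by move=> y; rewrite inE => /gcvg.
apply: le_trans (fatou mu mU _ _) _.
- by move=> n; exact: (measurable_funTS (mg n)).
- by move=> n y _; exact: g0.
exact: limn_einf_le_cst.
Qed.

(** A null set is enclosed in an open set of small length; h is fixed first to make h M small, then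
    the length is chosen in terms of h. *)
Lemma null_dominates_ball_average (e : R^nat) (M : R) :
  (forall n, 0 < e n) -> e n @[n --> \oo] --> 0 ->
  (forall n, \int[mu]_y (mu (ball y (2 * e n)) * ((2 * e n)^-1)%:E) <= M%:E)%E ->
  mu `<< leb.
Proof.
move=> e0 ecvg eM; apply/null_content_dominatesP => A mA A0.
apply/eqP; rewrite eq_le measure_ge0 andbT; apply/lee_addgt0Pr => eps eps0.
rewrite add0e.
(* Adding 1 keeps the divisor positive; this h makes h M at most eps / 2. *)
pose K : R := `|M| + 1.
have K0 : 0 < K by rewrite ltr_wpDl// normr_ge0.
pose h : R := eps / (2 * K).
have h0 : 0 < h by rewrite /h divr_gt0// mulr_gt0.
(* An open set of length at most 2 h eps contributes at most eps / 2 after division by 4h. *)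
have d0 : 0 < 2 * h * eps by rewrite mulr_gt0// mulr_gt0.
have A0' : leb A = 0%E by [].
have Afin : (leb A < +oo)%E by rewrite A0' ltry.
have [U [oU AU UA]] := lebesgue_regularity_outer mA Afin d0.
have mU : @measurable _ RM U by exact: open_measurable.
have lU : (leb U <= (2 * h * eps)%:E)%E.
  rewrite -(setDUK AU); apply: le_trans (measureU2 leb mA (measurableD mU mA)) _.
  by rewrite [X in (X + _)%E]A0' add0e ltW.
apply: (@le_trans _ _ (mu U)); first by apply: le_measure; rewrite ?inE.
apply: le_trans (measure_open_le e0 ecvg h0 eM oU) _.
apply: (@le_trans _ _ ((eps / 2)%:E + ((4 * h)^-1)%:E * (2 * h * eps)%:E)%E).
  apply: leeD.
    rewrite lee_fin /h mulrAC ler_pdivrMr ?mulr_gt0//.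
    rewrite (_ : eps / 2 * (2 * K) = eps * K); last by field.
    by rewrite ler_pM2l// /K; have := ler_norm M; lra.
  by rewrite lee_wpmul2l// lee_fin invr_ge0 mulr_ge0// ltW.
rewrite -EFinM -EFinD lee_fin le_eqVlt; apply/orP; left; apply/eqP.
by field; rewrite gt_eqF.
Qed.

Lemma nicely_shrinking_ball (e : R^nat) (x : R) :
  (forall n, 0 < e n) -> e n @[n --> \oo] --> 0 ->
  nicely_shrinking x (fun n => ball x (e n)).
Proof.
move=> e0 ecvg; split; first by move=> n; exact: measurable_ball.
exists (1, fun n => PosNum (e0 n)); split.
- exact: ltr01.
- exact: ecvg.
- by move=> n.
- by move=> n; rewrite mul1e.
Qed.

Lemma square_integrable_density (e : R^nat) (M : R) :
  (forall n, 0 < e n) -> e n @[n --> \oo] --> 0 ->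
  (forall n, \int[mu]_y (mu (ball y (2 * e n)) * ((2 * e n)^-1)%:E) <= M%:E)%E ->
  exists L : R -> R, [/\ measurable_fun setT L, forall x, 0 <= L x,
    forall A : set R, measurable A -> mu A = (\int[leb]_(x in A) (L x)%:E)%E
    & (\int[leb]_x ((L x) ^+ 2)%:E <= M%:E)%E].
Proof.
move=> e0 ecvg eM; have dom := null_dominates_ball_average e0 ecvg eM.
have [f [f0 ffin fint fE]] := radon_nikodym_sigma_finite dom.
(* The Radon-Nikodym derivative is finite everywhere, so [fine] loses nothing. *)
pose L x := fine (f x).
have LE x : (L x)%:E = f x by rewrite fineK.
have mf : measurable_fun [set: R] f := measurable_int _ fint.
have mL : measurable_fun [set: R] L.
  apply/measurable_EFinP; rewrite (_ : EFin \o L = f)//.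
  by apply/funext => x; exact: LE.
exists L; split => //.
- by move=> x; exact: fine_ge0.
- by move=> A mA; under eq_integral do rewrite LE; exact: fE.
have iL : leb.-integrable setT (EFin \o L).
  by apply: eq_integrable fint => // x _; rewrite /= LE.
have locL := open_integrable_locally openT iL.
have shr x := nicely_shrinking_ball x e0 ecvg.
have avgE n x : ball_average (e n) x =
    ((leb (ball x (e n)))^-1 * \int[leb]_(y in ball x (e n)) (L y)%:E)%E.
  rewrite /ball_average muleC lebesgue_measure_ball ?(ltW (e0 n))//.
  rewrite inver mulrn_eq0/= gt_eqF// mulr_natl; congr (_ * _)%E.
  rewrite fE; last exact: measurable_ball.
  by apply: eq_integral => y _; rewrite LE.
(* By Lebesgue differentiation the averages tend to [L] almost everywhere, so the limit inferior of
   their squares is L^2 there. *)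
apply: (@le_trans _ _ (\int[leb]_x
    limn_einf (fun n => ball_average (e n) x * ball_average (e n) x))%E).
  apply: ae_ge0_le_integral => //.
  - by move=> x _; rewrite lee_fin sqr_ge0.
  - by apply/measurable_EFinP; exact: measurable_funX.
  - by move=> x _; apply: limn_einf_ge0 => n; rewrite mule_ge0// ball_average_ge0.
  - apply: (@measurable_fun_limn_einf _ _ _
      (fun n x => ball_average (e n) x * ball_average (e n) x)%E) => n.
    exact: measurable_sqr_ball_average.
  have [N [mN N0 sN]] := lebesgue_differentiation locL.
  exists N; split => // x xN; apply: sN => /= Lx; apply: xN => _ /=.
  have cx := nice_lebesgue_differentiation shr locL Lx.
  have cx' : ball_average (e n) x @[n --> \oo] --> (L x)%:E.
    by under eq_cvg do rewrite avgE.
  have c2 : (ball_average (e n) x * ball_average (e n) x)%E @[n --> \oo] -->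
      ((L x)%:E * (L x)%:E)%E.
    exact: cvgeM.
  by rewrite (cvg_limn_einf_sup c2).1 -EFinM -expr2.
apply: le_trans (fatou leb measurableT _ _) _.
- move=> n.
  exact: measurable_sqr_ball_average.
- by move=> n x _; rewrite mule_ge0// ball_average_ge0.
apply: limn_einf_le_cst => n.
exact: le_trans (integral_sqr_ball_average (e0 n)) (eM n).
Qed.

End square_integrable_density.

(** * Occupation measures and close pairs of times *)

(** The grid point just below t is off by at most 1/(n+1) and stays nonnegative, so continuity on
    [0, +oo[ can be used along these points. *)
Lemma cvg_truncn_grid (R : realType) (t : R) : 0 <= t ->
  (Num.truncn (t * n.+1%:R))%:R / n.+1%:R @[n --> \oo] --> t.
Proof.
move=> t0; apply/cvgrPdist_le => e e0.
near=> n.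
have n0 : 0 < n.+1%:R :> R by rewrite ltr0n.
have tn0 : 0 <= t * n.+1%:R by rewrite mulr_ge0// ltW.
have /andP[lo hi] := truncn_itv tn0.
have ne : n.+1%:R^-1 <= e.
  near: n; have := @near_infty_natSinv_lt R (PosNum e0).
  by apply: filterS => n /ltW.
rewrite ger0_norm; last by rewrite subr_ge0 ler_pdivrMr.
apply: le_trans ne.
by rewrite lerBlDl -[X in _ + X]mul1r -mulrDl ler_pdivlMr// natr1 ltW.
Unshelve. all: by end_near. Qed.

Section joint_measurability.
Context d (Omega : measurableType d) (R : realType).
Notation RM := (measurableTypeR R).
Variable Z : R -> Omega -> R.
Hypothesis mZ : forall t, measurable_fun setT (Z t).
Hypothesis cZ : forall w, {within `[0, +oo[, continuous (fun t : R => Z t w)}.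

(** Freezing time at the grid point below it gives a process whose preimages are countable unions of
    rectangles; path continuity makes these processes converge pointwise. Negative times are sent to
    0, since nothing is known of the paths there. *)
Lemma measurable_continuous_process :
  measurable_fun [set: Omega * RM] (fun z => Z (Num.max 0 z.2) z.1).
Proof.
pose k n (t : RM) := Num.truncn (Num.max 0 t * n.+1%:R : R).
pose h n (z : Omega * RM) := Z ((k n z.2)%:R / n.+1%:R) z.1.
have p0 (t : R) : 0 <= Num.max 0 t by rewrite le_max lexx.
apply: (@measurable_fun_cvg _ _ R setT h) => [n _ A mA|z _].
  rewrite setTI.
  have -> : h n @^-1` A = \bigcup_j
      ((Z (j%:R / n.+1%:R) @^-1` A) `*` (k n @^-1` [set j])).
    apply/seteqP; split => -[w t] /=; first by exists (k n t).
    by case=> j _ /= [] + kj; rewrite /h /= kj.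
  apply: bigcupT_measurable => j; apply: measurableX.
    by rewrite -[X in measurable X]setTI; exact: mZ.
  have -> : k n @^-1` [set j] =
      (fun t : RM => Num.max 0 t * n.+1%:R : RM) @^-1` `[j%:R, j.+1%:R[.
    apply/seteqP; split => t /=; rewrite in_itv/=.
      by move=> <-; apply: truncn_itv; rewrite mulr_ge0.
    exact: truncn_def.
  rewrite -[X in measurable X]setTI.
  have mk : @measurable_fun _ _ RM RM setT (fun t => Num.max 0 t * n.+1%:R : R).
    by apply: measurable_funM => //; exact: measurable_maxr.
  apply: mk => //.
have := cZ => /(_ z.1) /subspace_continuousP /(_ (Num.max 0 z.2)).
rewrite /= in_itv/= andbT => /(_ (p0 _)) cz.
move=> Q /cz /= hQ.
have := cvg_truncn_grid (p0 z.2) hQ.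
case=> N _ NQ; exists N => // n Nn; apply: (NQ n Nn).
by rewrite /= in_itv/= andbT divr_ge0.
Qed.

End joint_measurability.

Section occupation.
Context {R : realType}.
Notation RM := (measurableTypeR R).
Notation leb := (@lebesgue_measure R).
Variable T : R.

Lemma lebesgue_measure_itv0_lty : (leb `[0%R, T] < +oo)%E.
Proof. by rewrite lebesgue_measure_itv/=; case: ifPn => // _; rewrite ltry. Qed.

(** Taken as a finite measure on the whole line, so that Tonelli and image measures apply without a
    domain. *)
Definition time_measure : {finite_measure set RM -> \bar R} :=
  mfrestr (measurable_itv `[0%R, T] : @measurable _ RM _) lebesgue_measure_itv0_lty.

Lemma integral_time_measure (f : R -> \bar R) : measurable_fun [set: R] f ->
  (forall t, 0 <= f t)%E ->
  (\int[time_measure]_t f t = \int[leb]_(t in `[0%R, T]) f t)%E.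
Proof.
move=> mf f0; have mI : @measurable _ RM `[0%R, T] by exact: measurable_itv.
rewrite -(setUv (`[0%R, T] : set RM)) ge0_integral_setU//=; last 3 first.
- exact: measurableC.
- by rewrite setUv.
- exact/disj_setPCl.
rewrite [X in (_ + X)%E](_ : _ = 0%E) ?adde0.
  by apply: eq_measure_integral => A mA AI; rewrite /= /mfrestr /mrestr setIidl.
apply: null_set_integral.
- exact: measurableC.
- exact: measurable_funTS.
by rewrite /null_set /= /mfrestr /mrestr setICl measure0.
Qed.

Variables (z : R -> R) (mz : @measurable_fun _ _ RM RM setT z).

(** The measurability proof is an argument so that the finite measure structure can be attached to
    the term. *)
Definition occupation_law & @measurable_fun _ _ RM RM setT z : set RM -> \bar R :=
  pushforward time_measure (z : RM -> RM).

Let occupation_law0 : occupation_law mz set0 = 0%E.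
Proof. by rewrite /occupation_law /pushforward preimage_set0 measure0. Qed.

Let occupation_law_ge0 A : (0 <= occupation_law mz A)%E.
Proof. exact: measure_ge0. Qed.

Let occupation_law_sigma_additive : semi_sigma_additive (occupation_law mz).
Proof.
exact: (@measure_semi_sigma_additive _ _ _
  (pushforward time_measure (z : RM -> RM))).
Qed.

HB.instance Definition _ := isMeasure.Build _ _ _ (occupation_law mz)
  occupation_law0 occupation_law_ge0 occupation_law_sigma_additive.

Let occupation_law_fin : fin_num_fun (occupation_law mz).
Proof.
move=> A mA; apply: fin_num_measure; rewrite -[X in measurable X]setTI.
exact: mz.
Qed.

HB.instance Definition _ := Measure_isFinite.Build _ _ _ (occupation_law mz)
  occupation_law_fin.

Lemma integral_occupation_law (f : R -> \bar R) : measurable_fun [set: R] f ->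
  (forall x, 0 <= f x)%E ->
  (\int[occupation_law mz]_x f x = \int[time_measure]_t f (z t))%E.
Proof.
move=> mf f0.
have := @ge0_integral_pushforward _ _ RM RM R z mz time_measure setT f
  measurableT mf.
by rewrite preimage_setT => <-.
Qed.

End occupation.

Section expected_close_pairs.
Context d (Omega : measurableType d) (R : realType) (P : probability Omega R).
Notation RM := (measurableTypeR R).
Notation leb := (@lebesgue_measure R).
Variables (T : R) (V : Omega -> R -> R).
Hypothesis T0 : 0 < T.
Hypothesis mV : measurable_fun [set: Omega * RM] (fun z => V z.1 z.2).
Local Notation nu := (time_measure T).

Definition close_times (r : R) (w : Omega) (t : R) : \bar R :=
  nu [set s : R | (`|V w t - V w s| < r)%R].

Lemma measurable_close_times r :
  measurable_fun [set: Omega * RM] (fun z => close_times r z.1 z.2).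
Proof.
pose A := [set q : (Omega * RM) * RM | (`|V q.1.1 q.1.2 - V q.1.1 q.2| < r)%R].
have mA : measurable A.
  apply: (@measurable_norm_sub_lt _ _ R (fun q => V q.1.1 q.1.2)
    (fun q => V q.1.1 q.2)).
    exact: (measurableT_comp mV measurable_fst).
  have mq : measurable_fun setT
      (fun q : (Omega * RM) * RM => (q.1.1, q.2) : Omega * RM).
    by apply: measurable_fun_pair => //; exact: measurableT_comp.
  exact: (measurableT_comp mV mq).
rewrite (_ : (fun z => _) = nu \o xsection A).
  exact: measurable_fun_xsection.
apply/funext => -[w t]; rewrite /close_times /=; congr (nu _).
by apply/seteqP; split => s; rewrite /xsection /= inE.
Qed.

(** For a path with occupation law mu, this is the integral of mu(B(y, r)) against mu(dy), written
    in terms of times. *)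
Definition close_pairs (r : R) (w : Omega) : \bar R :=
  (\int[nu]_t close_times r w t)%E.

Lemma close_times_ge0 r w t : (0 <= close_times r w t)%E.
Proof. exact: measure_ge0. Qed.

Lemma close_pairs_ge0 r w : (0 <= close_pairs r w)%E.
Proof. by apply: integral_ge0 => t _; exact: close_times_ge0. Qed.

Lemma measurable_close_pairs r :
  measurable_fun setT (close_pairs r).
Proof.
exact: (@measurable_fun_fubini_tonelli_F _ _ _ _ _ nu _
  (measurable_close_times r) (fun z => close_times_ge0 r z.1 z.2)).
Qed.

Lemma measurable_close_slice (r t : R) :
  measurable [set q : Omega * RM | (`|V q.1 t - V q.1 q.2| < r)%R].
Proof.
apply: (@measurable_norm_sub_lt _ _ R (fun q => V q.1 t)
  (fun q => V q.1 q.2)) => //.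
have mq : measurable_fun setT (fun q : Omega * RM => (q.1, t) : Omega * RM).
  exact: measurable_fun_pair.
exact: (measurableT_comp mV mq).
Qed.

Lemma expected_close_times (r t : R) :
  (\int[P]_w close_times r w t =
   \int[nu]_s P [set w | (`|V w t - V w s| < r)%R])%E.
Proof.
have mA := measurable_close_slice r t.
set A := [set _ | _] in mA.
transitivity (\int[P]_w (nu \o xsection A) w)%E.
  apply: eq_integral => w _; rewrite /close_times /=; congr (nu _).
  by apply/seteqP; split => s; rewrite /xsection /= inE.
transitivity (\int[nu]_s (P \o ysection A) s)%E; last first.
  apply: eq_integral => s _ /=; congr (P _).
  by apply/seteqP; split => w; rewrite /ysection /= inE.
rewrite -(@indic_fubini_tonelli_FE _ _ _ _ R nu A mA).
rewrite -(@indic_fubini_tonelli_GE _ _ _ _ R P A mA).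
exact: indic_fubini_tonelli.
Qed.

(** Tonelli brings the expectation inside both time integrals; the inner one is at most C r times
    the singular kernel integral, uniformly in t, and the outer one contributes the factor T. *)
Lemma expected_close_pairs_le (C H r : R) : 0 < C -> 0 < H -> H < 1 -> 0 < r ->
  (forall s t : R, (0 <= s)%R -> (0 <= t)%R -> s != t ->
    P [set w | (`|V w t - V w s| < r)%R] <= (C * r * `|t - s| `^ (- H))%:E)%E ->
  (\int[P]_w close_pairs r w <=
   (C * r * (2 * (T `^ (1 - H) / (1 - H))) * T)%:E)%E.
Proof.
move=> C0 H0 H1 r0 PV; have Cr0 : 0 < C * r by rewrite mulr_gt0.
have mP t : measurable_fun [set: R]
    (fun s : R => P [set w | (`|V w t - V w s| < r)%R]).
  rewrite (_ : (fun s => _) = P \o ysection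
      [set q : Omega * RM | (`|V q.1 t - V q.1 q.2| < r)%R]).
    exact: measurable_fun_ysection (measurable_close_slice r t).
  apply/funext => s /=; congr (P _).
  by apply/seteqP; split => w; rewrite /ysection /= inE.
have f0 (z : Omega * RM) := close_times_ge0 r z.1 z.2.
rewrite (@fubini_tonelli _ _ _ _ _ P nu _ (measurable_close_times r) f0).
have mG := @measurable_fun_fubini_tonelli_G _ _ _ _ _ P _
  (measurable_close_times r) f0.
rewrite integral_time_measure//; last by move=> t; exact: integral_ge0.
pose K := C * r * (2 * (T `^ (1 - H) / (1 - H))).
apply: (@le_trans _ _ (\int[leb]_(t in `[0%R, T]) K%:E)%E); last first.
  rewrite integral_cst; last exact: measurable_itv.
  by rewrite /= lebesgue_measure_itv/= lte_fin T0 -EFinB subr0 -EFinM.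
apply: ge0_le_integral => //.
- by move=> t _; apply: integral_ge0.
- exact: measurable_funTS.
move=> t /=; rewrite in_itv/= => /andP[t0 tT].
rewrite expected_close_times integral_time_measure//.
apply: (@le_trans _ _ (\int[leb]_(s in `[0%R, T])
    ((C * r)%:E * (`|t - s| `^ (- H))%:E))%E).
  apply: ae_ge0_le_integral => //.
  - exact: (measurable_funTS (mP t)).
  - by move=> s _; rewrite -EFinM lee_fin mulr_ge0 ?powR_ge0// ltW.
  - by apply: emeasurable_funM => //; exact: measurable_singular_kernel.
  (* The point s = t must be discarded: there the probability is 1, while the kernel takes the
     default value 0. *)
  exists [set t]; split => //; first exact: lebesgue_measure_set1.
  move=> s /= hs; apply: contrapT => /eqP st; apply: hs.
  rewrite in_itv/= => /andP[s0 sT]; rewrite -EFinM; exact: PV.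
rewrite ge0_integralZl//.
- rewrite /K [leRHS]EFinM lee_wpmul2l ?lee_fin ?(ltW Cr0)//.
  by apply: integral_singular_kernel_le => //; rewrite t0.
- exact: measurable_singular_kernel.
- by rewrite lee_fin ltW.
Qed.

End expected_close_pairs.

(** Every tail infimum lies below the limit inferior plus 1, so each tail contains a suitable index.
    [phi] need not be increasing: n <= phi n already preserves limits. *)
Lemma limn_einf_lty_subseq (R : realType) (u : (\bar R)^nat) :
  (forall n, 0 <= u n)%E -> (limn_einf u < +oo)%E ->
  exists (M : R) (phi : nat -> nat),
    forall n, (n <= phi n)%N /\ (u (phi n) <= M%:E)%E.
Proof.
move=> u0 uoo; have l0 := limn_einf_ge0 u0.
have lfin : limn_einf u \is a fin_num by rewrite ge0_fin_numE.
exists (fine (limn_einf u) + 1).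
have ex n : exists k, (n <= k)%N /\ (u k <= (fine (limn_einf u) + 1)%:E)%E.
  have : (einfs u n < (fine (limn_einf u) + 1)%:E)%E.
    apply: (@le_lt_trans _ _ (limn_einf u)); last first.
      by rewrite EFinD fineK// lteDl// lte01.
    rewrite limn_einf_lim; apply: lime_ge; first exact: is_cvg_einfs.
    by exists n => // m nm; exact: nondecreasing_einfs.
  by move=> /ereal_inf_lt [_ [k nk <-] /ltW uk]; exists k.
by exists (fun n => sval (cid (ex n))) => n; case: cid.
Qed.

(** * Local time of a single path *)

Section deterministic_local_time.
Context {R : realType}.
Notation RM := (measurableTypeR R).
Notation leb := (@lebesgue_measure R).
Variables (T : R) (z : R -> R).
Local Notation nu := (time_measure T).
(* The values of the path at negative times are unconstrained. *)
Let v (t : R) : R := z (Num.max 0 t).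
Hypothesis mv : @measurable_fun _ _ RM RM setT v.

Lemma occupation_measureE (A : set R) : measurable A ->
  occupation_measure z T A = occupation_law T mv A.
Proof.
move=> mA; rewrite /occupation_measure; congr (leb _).
apply/seteqP; split => t /=; rewrite in_itv/=.
  by move=> [/andP[t0 tT] Az]; split; [rewrite /v max_r|rewrite t0].
by move=> [Av /andP[t0 tT]]; split; [rewrite t0|move: Av; rewrite /v max_r].
Qed.

Lemma local_time_exists (e : R^nat) :
  (forall n, 0 < e n) -> e n @[n --> \oo] --> 0 ->
  (limn_einf (fun n => (\int[nu]_t nu [set s | (`|v t - v s| < 2 * e n)%R])
     * ((2 * e n)^-1)%:E) < +oo)%E ->
  exists L : R -> R, local_time z T L /\
    (\int[leb]_x ((L x) ^+ 2)%:E < +oo)%E.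
Proof.
move=> e0 ecvg.
set u := (u in limn_einf u) => uoo.
have c0 n : (0 <= ((2 * e n)^-1)%:E :> \bar R)%E.
  by rewrite lee_fin invr_ge0 mulr_ge0// ltW.
have u0 n : (0 <= u n)%E by rewrite /u mule_ge0// integral_ge0.
have [M [phi phiP]] := limn_einf_lty_subseq u0 uoo.
have e'0 n : 0 < e (phi n) by [].
have e'cvg : e (phi n) @[n --> \oo] --> 0.
  apply: cvg_comp ecvg => Q [N _ NQ]; exists N => // n Nn; apply: NQ.
  by apply: leq_trans Nn _; case: (phiP n).
have [|L [mL L0 LE L2]] := @square_integrable_density R (occupation_law T mv)
    (fun n => e (phi n)) M e'0 e'cvg.
  (* Transporting the integral from values to times turns the required integral into [u (phi n)]. *)
  move=> n; have [_] := phiP n; apply: le_trans.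
  have mb := measurable_fun_measure_ball (occupation_law T mv) (2 * e (phi n)).
  rewrite integral_occupation_law; last 2 first.
  - exact: emeasurable_funM.
  - by move=> x; rewrite mule_ge0.
  rewrite ge0_integralZr//; last exact: (measurableT_comp mb mv).
exists L; split; last by rewrite (le_lt_trans L2)// ltry.
split => // A mA.
by rewrite occupation_measureE// LE.
Qed.

End deterministic_local_time.

Lemma gfBm_local_time_exists (d : measure_display) (Omega : measurableType d)
    (R : realType) (P : probability Omega R) (H a b : R)
    (Z : R -> {RV P >-> R}) (T : R) :
  0 < H -> H < 1 -> (a, b) <> (0, 0) -> gfBm H a b Z -> 0 < T ->
  {ae P, forall w : Omega, exists L : R -> R,
    local_time (fun t : R => Z t w) T L /\
    (\int[lebesgue_measure]_x ((L x) ^+ 2)%:E < +oo)%E}.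
Proof.
move=> H0 H1 ab gZ T0.
have [C C0 PZ] := gfBm_small_ball H0 H1 ab gZ.
have cZ : forall w, {within `[0, +oo[, continuous (fun t : R => Z t w)}.
  by case: gZ => B [].
pose V w (t : R) := Z (Num.max 0 t) w.
have mV : measurable_fun [set: Omega * measurableTypeR R] (fun z => V z.1 z.2).
  exact: (measurable_continuous_process (fun t => measurable_funP (Z t)) cZ).
pose e n : R := n.+1%:R^-1.
have e0 n : 0 < e n by rewrite invr_gt0.
have ecvg : e n @[n --> \oo] --> 0 by exact: cvg_harmonic.
have e20 n : 0 < 2 * e n by rewrite mulr_gt0.
(* The radius 2 e_n in the bound on close pairs cancels the normalization, so [K] is independent of
   n. *)
pose K := C * (2 * (T `^ (1 - H) / (1 - H))) * T.
pose f n w := (close_pairs T V (2 * e n) w * ((2 * e n)^-1)%:E)%E.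
have c0 n : (0 <= ((2 * e n)^-1)%:E :> \bar R)%E by rewrite lee_fin invr_ge0 ltW.
have f0 n w : (0 <= f n w)%E by rewrite /f mule_ge0// close_pairs_ge0.
have mcp n := measurable_close_pairs T mV (2 * e n).
have mf n : measurable_fun setT (f n) by exact: emeasurable_funM.
have fK n : (\int[P]_w f n w <= K%:E)%E.
  rewrite /f ge0_integralZr//; last by move=> w _; exact: close_pairs_ge0.
  have PV (s t : R) : (0 <= s)%R -> (0 <= t)%R -> s != t ->
      (P [set w | (`|V w t - V w s| < 2 * e n)%R] <=
       (C * (2 * e n) * `|t - s| `^ (- H))%:E)%E.
    move=> s0 t0 st; have := PZ s t (2 * e n) s0 t0 st (e20 n).
    by rewrite /V !max_r.
  have cpK := expected_close_pairs_le T0 mV C0 H0 H1 (e20 n) PV.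
  apply: (@le_trans _ _ ((C * (2 * e n) * (2 * (T `^ (1 - H) / (1 - H))) * T)%:E
    * ((2 * e n)^-1)%:E)%E); first by rewrite lee_wpmul2r.
  rewrite -EFinM lee_fin le_eqVlt; apply/orP; left; apply/eqP.
  rewrite /K; move: (2 * (T `^ (1 - H) / (1 - H))) (e20 n) => S.
  by move: (2 * e n) => r r0; field; rewrite gt_eqF.
have lim_lty : (\int[P]_w limn_einf (f^~ w) < +oo)%E.
  apply: le_lt_trans (ltry K).
  apply: le_trans (fatou P measurableT mf _) _ => //.
  exact: limn_einf_le_cst.
have lim0 w : (0 <= limn_einf (f^~ w))%E by exact: limn_einf_ge0.
have ilim : P.-integrable setT (fun w => limn_einf (f^~ w)).
  apply/integrableP; split; first exact: measurable_fun_limn_einf.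
  by under eq_integral do rewrite gee0_abs//.
(* An integrable limit inferior is almost surely finite, and the rest is an argument for one
   path. *)
apply: filterS (integrable_ae measurableT ilim) => w /(_ I) wfin.
have mv : @measurable_fun _ _ (measurableTypeR R) (measurableTypeR R) setT (V w).
  move=> _ A mA; exact: (measurable_fun_pair2 w mV measurableT mA).
apply: (local_time_exists mv e0 ecvg).
by move: wfin; rewrite ge0_fin_numE.
Qed.

Theorem corollary1 (d : measure_display) (Omega : measurableType d)
    (R : realType) (P : probability Omega R) (H a b : R)
    (Z : R -> {RV P >-> R}) :
  0 < H -> H < 1 -> (a, b) <> (0, 0) -> gfBm H a b Z ->
  forall T : R, 0 < T ->
  exists L : Omega -> R -> R,
    {ae P, forall w : Omega, local_time (fun t : R => Z t w) T (L w)} /\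
    {ae P, forall w : Omega,
       (\int[lebesgue_measure]_x ((L w x) ^+ 2)%:E < +oo)%E}.
Proof.
move=> H0 H1 ab gZ T T0.
have aeL := gfBm_local_time_exists H0 H1 ab gZ T0.
pose good w (L : R -> R) := local_time (fun t : R => Z t w) T L /\
  (\int[lebesgue_measure]_x ((L x) ^+ 2)%:E < +oo)%E.
(* One choice serves both conclusions; on the exceptional paths the zero function is the default. *)
pose L w := xget (fun=> 0) [set L | good w L].
have goodL w : (exists L, good w L) -> good w (L w).
  by case=> L' gL'; exact: (xgetPex (fun=> 0 : R) (ex_intro _ L' gL')).
by exists L; split; apply: filterS aeL => w /goodL[].
Qed.
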